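(* Let $(V_1, V_2)$ be an irreducible $2$-finite pair. Then $1$ and $-1$ are the only nonzero eigenvalues of $C(V_1, V_2)$, $\operatorname{rank}[V_2^*,V_1] = 1$, there exists a unimodular constant $\alpha$ such that $\sigma([V_2^*,V_1])\setminus \{0\} = \{\alpha\}$, and $(V_1, V_2)$ is unitarily equivalent to $(M_z, \bar{\alpha}M_z)$ on $H^2(\mathbb{D})$. Conversely, if $\alpha$ is a unimodular constant, then $(M_z, \bar{\alpha}M_z)$ on $H^2(\mathbb{D})$ is an irreducible $2$-finite pair whose only nonzero eigenvalues of $C(M_z, \bar{\alpha}M_z)$ are $1$ and $-1$.
   Context: All Hilbert spaces are complex and separable. An isometric pair is a pair $(V_1,V_2)$ of commuting isometries. An isometry $V$ is a shift if $V^{*m}\to0$ strongly. A BCL pair is an isometric pair with $V_1V_2$ a shift. $[V_2^*,V_1] := V_2^*V_1 - V_1V_2^*$. A compact normal pair is a BCL pair with $[V_2^*,V_1]$ compact and normal. $C(V_1,V_2) := I - V_1V_1^* - V_2V_2^* + V_1V_2V_1^*V_2^*$. A $2$-finite pair is a compact normal pair with $\operatorname{rank} C(V_1,V_2)=2$. Irreducible: no closed subspace other than $\{0\}$ and the whole space invariant under $V_1,V_2,V_1^*,V_2^*$. $M_z$ is the unilateral shift (multiplication by $z$) on the Hardy space $H^2(\mathbb{D})$. Unitary equivalence of pairs means a single unitary intertwining both components. *)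

(* Defs.v *)
(* complex scalars R[i] (mathcomp-real-closed) over an
   arbitrary R : realType; classical layer of MathComp-Analysis for the
   lmodType structure on functions and classical booleans. *)
From HB Require Import structures.
From mathcomp Require Import all_boot all_order all_algebra.
From mathcomp Require Import complex.
From mathcomp Require Import boolp classical_sets functions reals.
From Stdlib Require Import ClassicalEpsilon.
From mathcomp Require Import ring.
Set Implicit Arguments. Unset Strict Implicit. Unset Printing Implicit Defensive.
Import Order.TTheory GRing.Theory Num.Theory.
Local Open Scope ring_scope.
Local Open Scope classical_set_scope.

(* Complex inner product spaces, Hilbert spaces and bounded operators *)
Section Hilbert.
Context {R : realType} {H : lmodType R[i]} (ip : H -> H -> R[i]).

(* the norm induced by the inner product *)
Definition nrm (x : H) : R[i] := sqrtC (ip x x).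

(* norm convergence of a sequence and Cauchy sequences *)
Definition cvg_to (u : nat -> H) (l : H) : Prop :=
  forall eps : R[i], 0 < eps ->
    exists N, forall n, (N <= n)%N -> nrm (u n - l) < eps.

Definition cauchy_seq (u : nat -> H) : Prop :=
  forall eps : R[i], 0 < eps ->
    exists N, forall m n, (N <= m)%N -> (N <= n)%N -> nrm (u m - u n) < eps.

(* (H, ip) is a complex separable Hilbert space; the inner product is
   linear in the first variable *)
Definition is_hilbert : Prop :=
  [/\ (forall (a : R[i]) (x y z : H), ip (a *: x + y) z = a * ip x z + ip y z),
      (forall x y : H, ip y x = (ip x y)^*),
      (forall x : H, 0 <= ip x x /\ (ip x x = 0 -> x = 0)),
      (forall u : nat -> H, cauchy_seq u -> exists l, cvg_to u l) &
      (exists d : nat -> H, forall (x : H) (eps : R[i]), 0 < eps ->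
          exists n, nrm (x - d n) < eps)].

Definition linear_op (T : H -> H) : Prop :=
  forall (a : R[i]) (x y : H), T (a *: x + y) = a *: T x + T y.

(* bounded linear operator *)
Definition bounded_op (T : H -> H) : Prop :=
  linear_op T /\ exists M : R[i], forall x, nrm (T x) <= M * nrm x.

Definition is_adjoint (T S : H -> H) : Prop :=
  forall x y, ip (T x) y = ip x (S y).

(* the Hilbert space adjoint T^* (unique when it exists, which is the case
   for every bounded operator on a Hilbert space) *)
Definition adj (T : H -> H) : H -> H :=
  epsilon (inhabits id) (is_adjoint T).

Definition op_isometry (V : H -> H) : Prop :=
  bounded_op V /\ forall x, adj V (V x) = x.

(* an op_isometry V is a shift if V^{*m} -> 0 strongly *)
Definition shift_op (V : H -> H) : Prop :=
  op_isometry V /\ forall x, cvg_to (fun m => iter m (adj V) x) 0.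

Definition isometric_pair (V1 V2 : H -> H) : Prop :=
  [/\ op_isometry V1, op_isometry V2 & (forall x, V1 (V2 x) = V2 (V1 x))].

Definition BCL_pair (V1 V2 : H -> H) : Prop :=
  isometric_pair V1 V2 /\ shift_op (V1 \o V2).

(* [V2^*, V1] = V2^* V1 - V1 V2^* *)
Definition cross_commutator (V1 V2 : H -> H) : H -> H :=
  fun x => adj V2 (V1 x) - V1 (adj V2 x).

(* compact operator: maps bounded sequences to sequences having a
   convergent subsequence *)
Definition compact_op (T : H -> H) : Prop :=
  bounded_op T /\
  forall u : nat -> H, (exists M : R[i], forall n, nrm (u n) <= M) ->
    exists phi : nat -> nat, (forall n, (phi n < phi n.+1)%N) /\
      exists l, cvg_to (fun n => T (u (phi n))) l.

Definition normal_op (T : H -> H) : Prop :=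
  bounded_op T /\ forall x, T (adj T x) = adj T (T x).

Definition compact_normal_pair (V1 V2 : H -> H) : Prop :=
  [/\ BCL_pair V1 V2, compact_op (cross_commutator V1 V2)
    & normal_op (cross_commutator V1 V2)].

(* C(V1,V2) = I - V1 V1^* - V2 V2^* + V1 V2 V1^* V2^* *)
Definition defect_op (V1 V2 : H -> H) : H -> H :=
  fun x => x - V1 (adj V1 x) - V2 (adj V2 x) + V1 (V2 (adj V1 (adj V2 x))).

(* the range of T has dimension exactly n *)
Definition op_has_rank (T : H -> H) (n : nat) : Prop :=
  exists e : 'I_n -> H,
    [/\ (forall i, exists x, T x = e i),
        (forall c : 'I_n -> R[i], \sum_i c i *: e i = 0 -> forall i, c i = 0)
      & (forall x, exists c : 'I_n -> R[i], T x = \sum_i c i *: e i)].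

Definition two_finite_pair (V1 V2 : H -> H) : Prop :=
  compact_normal_pair V1 V2 /\ op_has_rank (defect_op V1 V2) 2.

Definition closed_subspace (M : set H) : Prop :=
  [/\ M 0, (forall (a : R[i]) x y, M x -> M y -> M (a *: x + y))
    & (forall (u : nat -> H) l, (forall n, M (u n)) -> cvg_to u l -> M l)].

Definition invariant (T : H -> H) (M : set H) : Prop :=
  forall x, M x -> M (T x).

Definition irreducible_pair (V1 V2 : H -> H) : Prop :=
  forall M : set H, closed_subspace M ->
    invariant V1 M -> invariant V2 M -> invariant (adj V1) M ->
    invariant (adj V2) M -> M = [set 0] \/ M = setT.

Definition op_eigenvalue (T : H -> H) (l : R[i]) : Prop :=
  exists x, x != 0 /\ T x = l *: x.

(* op_spectrum: T - l I has no bounded two-sided inverse *)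
Definition op_spectrum (T : H -> H) (l : R[i]) : Prop :=
  ~ exists S : H -> H, bounded_op S /\
      forall x, S (T x - l *: x) = x /\ T (S x) - l *: S x = x.

End Hilbert.

(* unitary equivalence of pairs: one unitary intertwining both components *)
Definition unitarily_equivalent {R : realType} {H K : lmodType R[i]}
    (ipH : H -> H -> R[i]) (ipK : K -> K -> R[i])
    (A1 A2 : H -> H) (B1 B2 : K -> K) : Prop :=
  exists U : H -> K,
    [/\ (forall (a : R[i]) x y, U (a *: x + y) = a *: U x + U y),
        (forall y, exists x, U x = y),
        (forall x y, ipK (U x) (U y) = ipH x y)
      & (forall x, U (A1 x) = B1 (U x) /\ U (A2 x) = B2 (U x))].

(* The Hardy space H^2(D), realized (via Taylor coefficients) as       *)
(* { f = sum_n a_n z^n : sum_n |a_n|^2 < oo } with                     *)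
(* <f, g> = sum_n a_n conj(b_n), and M_z the multiplication by z.     *)
Section Hardy.
Context {R : realType}.
Local Notation C := R[i].

Definition sqsum (a : nat -> C) : Prop :=
  exists M : C, forall N, \sum_(n < N) `|a n| ^+ 2 <= M.

Definition sqsum_pred : {pred nat -> C} := fun a => `[< sqsum a >].

Lemma norm_sq_le (x y : C) : `|x + y| ^+ 2 <= 2 * `|x| ^+ 2 + 2 * `|y| ^+ 2.
Proof.
have H0 : 0 <= `|x - y| ^+ 2 by rewrite exprn_ge0.
have -> : 2 * `|x| ^+ 2 + 2 * `|y| ^+ 2 = `|x + y| ^+ 2 + `|x - y| ^+ 2.
  rewrite !normCK rmorphD rmorphB /=; ring.
by rewrite lerDl.
Qed.
End Hardy.

Section HardySpace.
Context {R : realType}.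
Local Notation C := R[i].

Lemma sqsum_submod : submod_closed (@sqsum_pred R).
Proof.
split.
  apply/asboolP; exists 0 => N; rewrite big1 // => i _.
  by rewrite normr0 expr0n.
move=> a u v /asboolP [Mu Hu] /asboolP [Mv Hv]; apply/asboolP.
exists (2 * `|a| ^+ 2 * Mu + 2 * Mv) => N.
apply: (le_trans (y := \sum_(n < N) (2 * `|a| ^+ 2 * `|u n| ^+ 2
                                     + 2 * `|v n| ^+ 2))).
  apply: ler_sum => n _.
  have := norm_sq_le (a * u n) (v n).
  by rewrite normrM exprMn mulrA.
rewrite big_split /= -!mulr_sumr.
have h2 : (0 : C) <= 2 by rewrite ler0n.
apply: lerD; apply: ler_wpM2l => //.
- by rewrite mulr_ge0 ?exprn_ge0.
- exact: Hu.
- exact: Hv.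
Qed.

HB.instance Definition _ :=
  GRing.isSubmodClosed.Build C (nat -> C) (@sqsum_pred R) sqsum_submod.

(* H^2(D): square-summable Taylor coefficient sequences *)
Record H2 := MkH2 { h2coef :> nat -> C; _ : h2coef \in @sqsum_pred R }.
HB.instance Definition _ := [isSub for h2coef].
HB.instance Definition _ := [Choice of H2 by <:].
HB.instance Definition _ := [SubChoice_isSubLmodule of H2 by <:].

(* limit of a sequence of complex numbers (junk value if it diverges) *)
Definition climit (s : nat -> C) : C :=
  epsilon (inhabits 0) (fun l => forall eps : C, 0 < eps ->
    exists N, forall n, (N <= n)%N -> `|s n - l| < eps).

(* <f, g> = sum_n a_n conj(b_n) *)
Definition h2inner (f g : H2) : C :=
  climit (fun N => \sum_(n < N) f n * (g n)^*).

(* M_z : multiplication by z, i.e. the unilateral shift of coefficients *)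
Definition coef_shift (a : nat -> C) : nat -> C :=
  fun n => if n is m.+1 then a m else 0.

Definition Mz (f : H2) : H2 := insubd (0 : H2) (coef_shift f).

End HardySpace.
Arguments H2 R : clear implicits.

(* Main.v *)
Require Import Defs.
From HB Require Import structures.
From mathcomp Require Import all_boot all_order all_algebra.
From mathcomp Require Import complex.
From mathcomp Require Import boolp classical_sets functions reals.
From Stdlib Require Import ClassicalEpsilon.
From mathcomp Require Import ring.
From mathcomp Require topology normedtype sequences.
Set Implicit Arguments. Unset Strict Implicit. Unset Printing Implicit Defensive.
Import Order.TTheory GRing.Theory Num.Theory.
Local Open Scope ring_scope.
Local Open Scope classical_set_scope.

(* Write [E] for the joint kernel of [V1^*] and [V2^*], [K] for the cross commutator
   and [D] for the defect operator.  [K] vanishes on the range of [V2] and has its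
   range in [ker V1^*]; normality puts the ranges of [K] and [K^*] into [E], on
   which [D] is the identity.  If [K = 0], then [D] is the projection onto the
   two-dimensional [E], and a vector of [E] generates a reducing subspace
   orthogonal to the rest of [E], against irreducibility.  Otherwise take a unit
   vector [x] of [E] in the range of [K]: as [D (V1 x) = - V2 (K x)] and
   [D (V2 x) = - V1 (K^* x)], the rank condition leaves [ran D] spanned by [x] and
   [V2 (K x)], so [x] spans [E] and [V1 x = alpha V2 x] with [|alpha| = 1].  Then
   the vectors [V1^n x] span a reducing subspace, hence form an orthonormal basis,
   and [V2 = alpha^* V1] with [V1] a shift of multiplicity one.  Both implications
   are then read off from
     [K f = alpha <f, x> x]  and  [D f = <f, x> x - <f, V1 x> V1 x]. *)

(** * Limits of complex sequences *)

Section ScalarLimits.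
Context {R : realType}.
Local Notation C := R[i].
Implicit Types (s t : nat -> C) (l a M : C).

Definition clim s l : Prop :=
  forall eps : C, 0 < eps ->
    exists N, forall n, (N <= n)%N -> `|s n - l| < eps.

Lemma clim_unique s l l' : clim s l -> clim s l' -> l = l'.
Proof.
move=> h h'; apply/eqP; rewrite -subr_eq0; apply/negPn/negP => ne.
have e0 : 0 < `|l - l'| / 2 by rewrite divr_gt0 ?normr_gt0.
have [N hN] := h _ e0; have [N' hN'] := h' _ e0.
have := hN _ (leq_maxl N N'); have := hN' _ (leq_maxr N N').
set n := maxn N N' => a b.
have : `|l - l'| < `|l - l'|.
  rewrite {2}[`|l - l'|]splitr.
  apply: le_lt_trans (ltrD b a); rewrite distrC (distrC (s n) l).
  rewrite -[l' - l](subrKA (s n)) (le_trans (ler_normD _ _)) //.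
  by rewrite addrC (distrC (s n) l) (distrC l').
by rewrite ltxx.
Qed.

Lemma climitE s l : clim s l -> climit s = l.
Proof.
move=> h; apply: (@clim_unique s) => //.
by rewrite /climit; apply: (epsilon_spec _ (clim s)); exists l.
Qed.

Lemma clim_eventually s l N : (forall n, (N <= n)%N -> s n = l) -> clim s l.
Proof. by move=> h eps e0; exists N => n /h ->; rewrite subrr normr0. Qed.

Lemma climD s t l l' : clim s l -> clim t l' -> clim (fun n => s n + t n) (l + l').
Proof.
move=> h h' eps e0; have e2 : 0 < eps / 2 by rewrite divr_gt0.
have [N hN] := h _ e2; have [N' hN'] := h' _ e2.
exists (maxn N N') => n; rewrite geq_max => /andP[/hN a /hN' b].
rewrite opprD addrACA [eps]splitr; exact: le_lt_trans (ler_normD _ _) (ltrD a b).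
Qed.

Lemma climZ a s l : clim s l -> clim (fun n => a * s n) (a * l).
Proof.
move=> h eps e0.
have p : 0 < `|a| + 1 by rewrite ltr_wpDl.
have e2 : 0 < eps / (`|a| + 1) by rewrite divr_gt0.
have [N hN] := h _ e2; exists N => n /hN; rewrite -mulrBr normrM.
rewrite ltr_pdivlMr // mulrC; apply: le_lt_trans.
by rewrite ler_wpM2r // lerDl.
Qed.

Lemma clim_conj s l : clim s l -> clim (fun n => (s n)^*) l^*.
Proof.
by move=> h eps /h [N hN]; exists N => n /hN; rewrite -rmorphB norm_conjC.
Qed.

Lemma clim_shift s l : clim (fun n => s n.+1) l <-> clim s l.
Proof.
split=> h eps /h [N hN].
  by exists N.+1 => -[|n] // /hN.
by exists N => n Nn; apply: hN; rewrite ltnW.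
Qed.

Lemma climit_shift s : climit (fun n => s n.+1) = climit s.
Proof.
rewrite /climit; congr epsilon; apply: funext => l; apply: propext.
exact: clim_shift.
Qed.

Lemma clim_ext s t l : s =1 t -> clim s l -> clim t l.
Proof. by move=> /funext ->. Qed.

(** In the order of [R[i]], [0 < eps] forces [eps] to be real, so the Archimedean property of [R]
    applies to its real part. *)
Lemma archiC (eps : C) : 0 < eps -> exists N, forall n, (N <= n)%N -> n.+1%:R^-1 < eps.
Proof.
rewrite ltcE /= => /andP[/eqP im re].
pose N := Num.bound (complex.Re eps)^-1.
have hN : (complex.Re eps)^-1 < N%:R.
  by apply: archi_boundP; rewrite invr_ge0 ltW.
exists N => n Nn.
have -> : n.+1%:R^-1 = (n.+1%:R^-1 : R)%:C%C :> C by rewrite fmorphV rmorph_nat.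
rewrite ltcE /= im eqxx /=.
rewrite -[X in _ < X]invrK ltf_pV2 ?posrE ?invr_gt0 // ?ltr0n //.
by apply: lt_le_trans hN _; rewrite ler_nat ltnW.
Qed.

Lemma clim_invS : clim (fun n => n.+1%:R^-1) 0.
Proof.
move=> eps /archiC [N hN]; exists N => n /hN; rewrite subr0 ger0_norm //.
by rewrite invr_ge0.
Qed.

(** Comparability with [b] gives every value of [f] the imaginary part of [b]; the infimum is
    therefore taken on real parts in [R]. *)
Lemma inf_existsC (T : Type) (f : T -> C) (b : C) (x0 : T) :
  (forall x, b <= f x) ->
  exists m, (forall x, m <= f x) /\ (forall eps, 0 < eps -> exists x, f x < m + eps).
Proof.
move=> hb; pose E := range (fun x => complex.Re (f x)).
have hE : has_inf E.
  split; first by exists (complex.Re (f x0)), x0.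
  by exists (complex.Re b) => _ [x _ <-]; move: (hb x); rewrite lecE => /andP[].
have im x : complex.Im (f x) = complex.Im b.
  by move: (hb x); rewrite lecE => /andP[/eqP].
exists (inf E +i* complex.Im b)%C; split=> [x|eps].
  rewrite lecE /= im eqxx /=; apply: ge_inf; first exact: hE.2.
  by exists x.
rewrite ltcE /= => /andP[/eqP ei er].
have [_ [x _ <-] ht] := inf_adherent er hE.
exists x; rewrite ltcE im.
by case: eps ei er ht => u v /= -> _ ht; rewrite addr0 eqxx.
Qed.

Lemma clim_nondecreasing s M : (forall n, s n <= s n.+1) -> (forall n, s n <= M) ->
  exists l, clim s l /\ forall n, s n <= l.
Proof.
move=> mono bd.
have [|m [hm hi]] := @inf_existsC nat (fun n => - s n) (- M) 0%N.
  by move=> n; rewrite lerN2.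
exists (- m); split=> [eps e0|n]; last by rewrite lerNr.
have [N hN] := hi _ e0; exists N => n Nn.
have sN : s N <= s n.
  by elim: n Nn => [|n IH]; [case: N {hN}|rewrite leq_eqVlt => /orP[/eqP->//|/IH/le_trans]; apply].
rewrite opprK ler0_norm; last by rewrite -lerBrDr sub0r lerNr.
rewrite opprD; have : - s n <= - s N by rewrite lerN2.
by move=> /le_lt_trans/(_ hN); rewrite ltrBlDl.
Qed.

Lemma clim_sub s (phi : nat -> nat) l : (forall n, (phi n < phi n.+1)%N) ->
  clim s l -> clim (s \o phi) l.
Proof.
move=> inc h eps /h [N hN]; exists N => n Nn; apply: hN; apply: leq_trans Nn _.
by elim: n => // n IH; apply: leq_ltn_trans IH (inc n).
Qed.

End ScalarLimits.

(** * The Bolzano-Weierstrass theorem for complex sequences *)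

Section BolzanoWeierstrass.
Import topology normedtype sequences numFieldNormedType.Exports.
Context {R : realType}.
Local Notation C := R[i].

Lemma bolzano_weierstrass_real (u : nat -> R) M : (forall n, `|u n| <= M) ->
  exists phi : nat -> nat, (forall n, (phi n < phi n.+1)%N) /\
    exists l, forall eps, 0 < eps -> exists N, forall n, (N <= n)%N -> `|u (phi n) - l| < eps.
Proof.
move=> bd.
have : (u n @[n --> \oo]) `[- M, M]%classic.
  by exists 0%N => // n _ /=; rewrite in_itv /= -ler_norml.
move=> /(@segment_compact R (- M) M) [l [_]].
move=> /cluster_eventually_cvg [phi /increasing_seqP inc h].
exists phi; split=> //; exists l => eps e0.
move/cvgrPdist_lt: h => /(_ _ e0) [N _ hN].
by exists N => n Nn; rewrite distrC; apply: hN.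
Qed.

Lemma bolzano_weierstrass (u : nat -> C) M : (forall n, `|u n| <= M) ->
  exists phi : nat -> nat, (forall n, (phi n < phi n.+1)%N) /\
    exists l, clim (u \o phi) l.
Proof.
move=> bd.
have re n : `|complex.Re (u n)| <= complex.Re M.
  by have := le_trans (normc_ge_Re (u n)) (bd n); rewrite lecE => /andP[].
have im n : `|complex.Im (u n)| <= complex.Re M.
  (* Multiplication by [i] turns the imaginary part, up to sign, into the real part, so the same
     bound serves again. *)
  have : `|u n * 'i%C| <= M.
    by rewrite normrM [`|'i%C|]normc_def /= expr0n expr1n add0r sqrtr1 mulr1.
  move/(le_trans (normc_ge_Re _)); rewrite ReiNIm normrN lecE.
  by move=> /andP[].
have [phi [pinc [a ha]]] := bolzano_weierstrass_real re.
have [psi [qinc [b hb]]] := bolzano_weierstrass_real (fun n => im (phi n)).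
have psi_ge n : (n <= psi n)%N.
  by elim: n => // n IH; apply: leq_ltn_trans IH (qinc n).
have pmono : {homo phi : m n / (m < n)%N} by apply: (homo_ltn ltn_trans).
exists (phi \o psi); split=> [n|]; first exact: pmono.
exists (a +i* b)%C => eps; rewrite ltcE /= => /andP[/eqP ei er].
have e2 : 0 < complex.Re eps / 2 by rewrite divr_gt0.
have [N hN] := ha _ e2; have [N' hN'] := hb _ e2.
exists (maxn N N') => n; rewrite geq_max => /andP[n1 n2].
have {}hN := hN _ (leq_trans n1 (psi_ge n)); have {}hN' := hN' _ n2.
have normR (x : R) : `|(x%:C)%C| = (`|x|%:C)%C.
  by rewrite normc_def /= expr0n addr0 sqrtr_sqr.
rewrite [_ - _]complexE; apply: le_lt_trans (ler_normD _ _) _.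
rewrite normrM [`|'i%C|]normc_def /= expr0n expr1n add0r sqrtr1 mul1r !normR.
rewrite !raddfB -rmorphD /= ltcE /= ei eqxx /= [X in _ < X]splitr; exact: ltrD.
Qed.
End BolzanoWeierstrass.

(** * Inner product spaces *)

(** The algebraic clauses of [is_hilbert], isolated so that the lemmas below apply to [H] and to
    [H2] alike; completeness is assumed separately where a limit has to exist. *)
Definition inner_product {R : realType} {H : lmodType R[i]} (ip : H -> H -> R[i]) : Prop :=
  [/\ (forall (a : R[i]) (x y z : H), ip (a *: x + y) z = a * ip x z + ip y z),
      (forall x y : H, ip y x = (ip x y)^*)
    & (forall x : H, 0 <= ip x x /\ (ip x x = 0 -> x = 0))].

Section InnerProduct.
Context {R : realType} {H : lmodType R[i]} (ip : H -> H -> R[i]).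
Hypothesis ipP : inner_product ip.
Local Notation C := R[i].
Implicit Types (x y z : H) (a : C) (T S : H -> H).

Lemma ipC x y : ip y x = (ip x y)^*. Proof. by case: ipP. Qed.
Lemma ip_ge0 x : 0 <= ip x x. Proof. by case: ipP => _ _ /(_ x) []. Qed.
Lemma ip_eq0 x : ip x x = 0 -> x = 0. Proof. by case: ipP => _ _ /(_ x) []. Qed.
Lemma ipDl x y z : ip (x + y) z = ip x z + ip y z.
Proof. by case: ipP => h _ _; rewrite -[x]scale1r h mul1r scale1r. Qed.
Lemma ip0l y : ip 0 y = 0.
Proof. by apply: (addrI (ip 0 y)); rewrite -ipDl !addr0. Qed.
Lemma ipZl a x y : ip (a *: x) y = a * ip x y.
Proof. by case: ipP => h _ _; rewrite -[a *: x]addr0 h ip0l addr0. Qed.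
Lemma ipNl x y : ip (- x) y = - ip x y.
Proof. by rewrite -scaleN1r ipZl mulN1r. Qed.
Lemma ipBl x y z : ip (x - y) z = ip x z - ip y z.
Proof. by rewrite ipDl ipNl. Qed.
Lemma ip0r y : ip y 0 = 0. Proof. by rewrite ipC ip0l rmorph0. Qed.
Lemma ipDr x y z : ip x (y + z) = ip x y + ip x z.
Proof. by rewrite ipC ipDl rmorphD /= -!ipC. Qed.
Lemma ipZr a x y : ip x (a *: y) = a^* * ip x y.
Proof. by rewrite ipC ipZl rmorphM /= -ipC. Qed.
Lemma ipNr x y : ip x (- y) = - ip x y.
Proof. by rewrite ipC ipNl rmorphN /= -ipC. Qed.
Lemma ipBr x y z : ip x (y - z) = ip x y - ip x z.
Proof. by rewrite ipDr ipNr. Qed.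

Definition ipE := (ipDl, ipDr, ipNl, ipNr, ipZl, ipZr, ip0l, ip0r).

Lemma ip_suml (I : Type) (r : seq I) (F : I -> H) y :
  ip (\sum_(i <- r) F i) y = \sum_(i <- r) ip (F i) y.
Proof. by elim/big_rec2: _ => [|i u v _ <-]; rewrite ?ip0l ?ipDl. Qed.

Lemma ipZZ a x : ip (a *: x) (a *: x) = `|a| ^+ 2 * ip x x.
Proof. by rewrite ipZl ipZr mulrA -normCK. Qed.

Lemma ip_real x : (ip x x)^* = ip x x. Proof. by rewrite -ipC. Qed.

Lemma ip_gt0 x : x != 0 -> 0 < ip x x.
Proof.
by move=> nx; rewrite lt0r ip_ge0 andbT; apply: contra nx => /eqP/ip_eq0 ->.
Qed.

Lemma ip_inj x y : (forall z, ip z x = ip z y) -> x = y.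
Proof.
by move=> h; apply/eqP; rewrite -subr_eq0; apply/eqP/ip_eq0; rewrite ipBr h subrr.
Qed.

(** The square norm of [<y,y> x - <x,y> y] is [<y,y>] times the difference of the two sides. *)
Lemma cauchy_schwarz x y : `|ip x y| ^+ 2 <= ip x x * ip y y.
Proof.
have [->|ny] := eqVneq y 0; first by rewrite !ip0r normr0 expr0n mulr0.
have := ip_ge0 (ip y y *: x - ip x y *: y).
rewrite !ipE ip_real (ipC x y) normCK => h.
rewrite -subr_ge0 -(pmulr_rge0 _ (ip_gt0 ny)).
by apply: le_trans h _; rewrite le_eqVlt; apply/orP; left; apply/eqP; ring.
Qed.

Lemma ipD_le x y : ip (x + y) (x + y) <= 2 * ip x x + 2 * ip y y.
Proof.
rewrite -subr_ge0; apply: le_trans (ip_ge0 (x - y)) _.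
by rewrite le_eqVlt; apply/orP; left; apply/eqP; rewrite !ipE; ring.
Qed.

Lemma sqr_nrm x : nrm ip x ^+ 2 = ip x x. Proof. exact: sqrtCK. Qed.

Lemma nrm_ge0 x : 0 <= nrm ip x. Proof. by rewrite sqrtC_ge0 ip_ge0. Qed.

Lemma nrm_lt x eps : 0 < eps -> (nrm ip x < eps) = (ip x x < eps ^+ 2).
Proof. by move=> e0; rewrite -sqr_nrm ltr_sqr ?nnegrE ?nrm_ge0 // ltW. Qed.

Lemma nrm_leM M x y : 0 <= M -> ip y y <= M ^+ 2 * ip x x -> nrm ip y <= M * nrm ip x.
Proof.
move=> M0; rewrite -!sqr_nrm -exprMn ler_sqr // nnegrE ?nrm_ge0 //.
by rewrite mulr_ge0 ?nrm_ge0.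
Qed.

Lemma norm_ip_le x y : `|ip x y| <= nrm ip x * nrm ip y.
Proof.
rewrite -ler_sqr ?nnegrE ?mulr_ge0 ?nrm_ge0 // exprMn !sqr_nrm.
exact: cauchy_schwarz.
Qed.

Lemma cvg_toP (u : nat -> H) l :
  cvg_to ip u l <-> forall eps, 0 < eps -> exists N, forall n, (N <= n)%N ->
     ip (u n - l) (u n - l) < eps.
Proof.
split=> h eps e0.
  have [|N hN] := h (sqrtC eps); first by rewrite sqrtC_gt0.
  by exists N => n /hN; rewrite nrm_lt ?sqrtC_gt0 // sqrtCK.
have [|N hN] := h (eps ^+ 2); first by rewrite exprn_gt0.
by exists N => n /hN; rewrite nrm_lt.
Qed.

Lemma cvg_to_clim (u : nat -> H) l :
  cvg_to ip u l <-> clim (fun n => ip (u n - l) (u n - l)) 0.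
Proof.
rewrite cvg_toP; split=> h eps /h [N hN]; exists N => n /hN;
by rewrite subr0 ger0_norm ?ip_ge0.
Qed.

Lemma cvg_to_ip (u : nat -> H) l y : cvg_to ip u l -> clim (fun n => ip (u n) y) (ip l y).
Proof.
move=> h eps e0; have p : 0 < nrm ip y + 1 by rewrite ltr_wpDl ?nrm_ge0.
have [|N hN] := h (eps / (nrm ip y + 1)); first by rewrite divr_gt0.
exists N => n /hN; rewrite ltr_pdivlMr // -ipBl; apply: le_lt_trans.
apply: le_trans (norm_ip_le _ _) _.
by rewrite ler_wpM2l ?nrm_ge0 // lerDl.
Qed.

Lemma orthogonal_closed (E : set H) :
  closed_subspace ip [set y | forall x, E x -> ip y x = 0].
Proof.
split=> [x _|a x y hx hy z Ez|u l hu hl x Ex]; first by rewrite ip0l.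
  by rewrite !ipE hx ?hy // mulr0 addr0.
apply: clim_unique (cvg_to_ip x hl) _.
by apply: (@clim_eventually _ _ _ 0%N) => n _; apply: hu.
Qed.

(** Adjoints are unique because the inner product separates points, so exhibiting one determines the
    [epsilon] choice made by [adj]. *)
Lemma adjoint_eq T S : is_adjoint ip T S -> adj ip T = S.
Proof.
move=> h; have h' : is_adjoint ip T (adj ip T).
  by apply: (epsilon_spec _ (is_adjoint ip T)); exists S.
by apply: funext => y; apply: ip_inj => z; rewrite -h -h'.
Qed.

Lemma adjoint_sym T S : is_adjoint ip T S -> is_adjoint ip S T.
Proof. by move=> h x y; rewrite ipC -h -ipC. Qed.

Lemma adjoint_linear T S : is_adjoint ip T S -> linear_op T.
Proof.
move=> /adjoint_sym h a x y; apply: ip_inj => z.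
by rewrite !ipE -!h !ipE.
Qed.

Lemma bounded_opP T M : linear_op T -> 0 <= M ->
  (forall x, ip (T x) (T x) <= M * ip x x) -> bounded_op ip T.
Proof.
move=> lT M0 h; split=> //; exists (sqrtC M) => x.
by apply: nrm_leM; rewrite ?sqrtC_ge0 // sqrtCK.
Qed.

(** * Riesz representation and existence of adjoints *)

Section Complete.
Hypothesis complete : forall u : nat -> H, cauchy_seq ip u -> exists l, cvg_to ip u l.

Lemma cauchy_cvg (u : nat -> H) (eps : nat -> C) : clim eps 0 ->
  (forall m n, (m <= n)%N -> ip (u m - u n) (u m - u n) <= eps m) ->
  exists l, cvg_to ip u l.
Proof.
move=> he h; apply: complete => e e0.
have [|N hN] := he (e ^+ 2); first by rewrite exprn_gt0.
have key m n : (N <= m)%N -> (m <= n)%N -> nrm ip (u m - u n) < e.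
  move=> Nm mn; rewrite nrm_lt //; apply: le_lt_trans (h _ _ mn) _.
  have := hN _ Nm; rewrite subr0; apply: le_lt_trans; apply: real_ler_norm.
  by apply: ger0_real; apply: le_trans (ip_ge0 _) (h _ _ (leqnn m)).
exists N => m n Nm Nn; have [mn|nm] := leqP m n; first exact: key.
by rewrite nrm_lt // -opprB ipNl ipNr opprK -nrm_lt // key // ltnW.
Qed.

(* The representing vector minimizes [|x|^2 - 2 Re (phi x)]. *)
Lemma riesz (phi : H -> C) (K : C) :
  (forall a x y, phi (a *: x + y) = a * phi x + phi y) ->
  0 <= K -> (forall x, `|phi x| <= K * nrm ip x) ->
  exists s, forall x, phi x = ip x s.
Proof.
move=> lin K0 bd.
have phi0 : phi 0 = 0.
  by have := lin (-1) 0 0; rewrite scaler0 addr0 mulN1r addNr.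
have phiZ a x : phi (a *: x) = a * phi x by rewrite -[a *: x]addr0 lin phi0 addr0.
have phiD x y : phi (x + y) = phi x + phi y by rewrite -[x]scale1r lin mul1r scale1r.
pose J x := ip x x - phi x - (phi x)^*.
(* [J x >= |x|^2 - 2 K |x|], and adding [K^2] leaves the square [(K - |x|)^2]. *)
have Jb x : - (K ^+ 2) <= J x.
  rewrite -subr_ge0.
  have h : phi x + (phi x)^* <= 2 * (K * nrm ip x).
    have h1 : phi x + (phi x)^* <= `|phi x + (phi x)^*|.
      apply: real_ler_norm; apply/CrealP.
      by rewrite rmorphD /= conjCK addrC.
    apply: le_trans h1 _; apply: le_trans (ler_normD _ _) _.
    by rewrite norm_conjC -mulr2n -[_ *+ 2]mulr_natl ler_wpM2l.
  apply: le_trans (_ : (K - nrm ip x) ^+ 2 <= _).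
    by rewrite real_exprn_even_ge0 // rpredB // ger0_real // nrm_ge0.
  rewrite -subr_ge0 in h; rewrite -subr_ge0; apply: le_trans h _.
  rewrite le_eqVlt; apply/orP; left; apply/eqP; rewrite /J -sqr_nrm; ring.
have [m [mlow mapp]] := inf_existsC 0 Jb.
have invS0 n : 0 < (n.+1%:R^-1 : C) by rewrite invr_gt0 ltr0n.
pose u n := projT1 (constructive_indefinite_description _ (mapp _ (invS0 n))).
have hu n : J (u n) < m + n.+1%:R^-1.
  by rewrite /u; case: constructive_indefinite_description.
(* The parallelogram law for [J]: two near-minimizers are close, as [J] at their midpoint is at
   least [m]. Hence the minimizing sequence [u] is Cauchy. *)
have par x y : J x + J y = 2 * J (2^-1 *: (x + y)) + 2^-1 * ip (x - y) (x - y).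
  have n2 : (2 : C) != 0 by rewrite pnatr_eq0.
  rewrite /J phiZ phiD !ipE fmorphV rmorph_nat !rmorphM rmorphD fmorphV rmorph_nat.
  by field.
have [l hl] : exists l, cvg_to ip u l.
  apply: (@cauchy_cvg _ (fun n => 4 * n.+1%:R^-1)).
    by rewrite -(mulr0 4); apply: climZ; apply: clim_invS.
  move=> p q pq.
  have h2 : J (u p) + J (u q) <= 2 * m + 2 * p.+1%:R^-1.
    rewrite -mulrDr mulr_natl mulr2n; apply: lerD; first exact/ltW.
    apply: le_trans (ltW (hu q)) _; rewrite lerD2l lef_pV2 ?posrE ?ltr0n //.
    by rewrite ler_nat.
  rewrite par -lerBrDl in h2.
  have h3 : 2 * m <= 2 * J (2^-1 *: (u p + u q)) by rewrite ler_wpM2l.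
  have h4 : 2^-1 * ip (u p - u q) (u p - u q) <= 2 * p.+1%:R^-1.
    apply: le_trans h2 _; rewrite -addrA addrCA gerDl subr_le0 //.
  have -> : (4 : C) = 2 * 2 by rewrite -natrM.
  by rewrite -mulrA -ler_pdivrMl.
exists l => x; symmetry.
apply: clim_unique (_ : clim (fun n => ip x (u n)) _).
  have := clim_conj (cvg_to_ip x hl); rewrite -ipC; apply: clim_ext => n.
  by rewrite -ipC.
move=> e e0.
have q0 : 0 < ip x x + 1 by rewrite ltr_wpDl ?ip_ge0.
have [|N hN] := @clim_invS R (e ^+ 2 / (ip x x + 1)).
  by rewrite divr_gt0 ?exprn_gt0.
exists N => n /hN; rewrite subr0 ger0_norm ?(ltW (invS0 n)) // ltr_pdivlMr // => hn.
rewrite -ltr_sqr ?nnegrE ?normr_ge0 ?(ltW e0) //; apply: le_lt_trans hn.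
(* Moving [u n] by [- t g^* x] lowers [J] by [|g|^2 t (2 - t <x,x>)]. Since [t <x,x> <= 1], this is
   at least [|g|^2 t]; as [J] stays above [m], it is below [1/(n+1)], so the error [g] tends to
   [0]. *)
set g : C := ip x (u n) - phi x; set t : C := (ip x x + 1)^-1.
have tr : t^* = t by rewrite /t fmorphV rmorphD /= rmorph1 ip_real.
have t0 : 0 < t by rewrite invr_gt0.
have Jg : J (u n - (t * g^*) *: x) =
    J (u n) - (`|g| ^+ 2 * t *+ 2 - `|g| ^+ 2 * t * (t * ip x x)).
  rewrite -scaleNr /J phiD phiZ normCK !ipE !(rmorphD, rmorphN, rmorphM) /= conjCK tr /g.
  rewrite !conjCK (ipC x (u n)); ring.
have := le_lt_trans (mlow (u n - (t * g^*) *: x)) _.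
move=> /(_ (m + n.+1%:R^-1 - (`|g| ^+ 2 * t *+ 2 - `|g| ^+ 2 * t * (t * ip x x)))).
rewrite Jg ltrD2r => /(_ (hu n)); rewrite -addrA ltrDl subr_gt0 => h.
rewrite -ler_pdivrMr //; apply/ltW; apply: le_lt_trans h.
rewrite mulr2n -addrA lerDl -{1}[_ * t]mulr1 -mulrBr mulr_ge0 //.
  by rewrite mulr_ge0 ?exprn_ge0 // ltW.
by rewrite subr_ge0 mulrC ler_pdivrMr // mul1r lerDl.
Qed.

Lemma adjointP T : bounded_op ip T -> is_adjoint ip T (adj ip T).
Proof.
case=> lT [M bT]; suff /choice [S hS] : forall y, exists s, forall x, ip (T x) y = ip x s.
  by rewrite (@adjoint_eq T S) // => x y; apply: hS.
(* [bounded_op] puts no sign condition on [M], whence the constant [|M|] in the bound required by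
   [riesz]. *)
move=> y; apply: (@riesz (fun x => ip (T x) y) (`|M| * nrm ip y)) => [a x z||x].
- by rewrite lT !ipE.
- by rewrite mulr_ge0 ?nrm_ge0.
apply: le_trans (norm_ip_le _ _) _; rewrite mulrAC ler_wpM2r ?nrm_ge0 //.
have := bT x => h; have := le_trans (nrm_ge0 _) h => h0.
apply: le_trans h _; rewrite -[leRHS](ger0_norm (mulr_ge0 _ (nrm_ge0 x))) //.
by rewrite normrM normr_id -normrM ger0_norm.
Qed.

End Complete.
End InnerProduct.

(** * Shifts of multiplicity one *)

Section LinearOp.
Context {R : realType} {H : lmodType R[i]} (T : H -> H).
Hypothesis lT : linear_op T.

Lemma linear_opD x y : T (x + y) = T x + T y.
Proof. by rewrite -[x]scale1r lT !scale1r. Qed.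
Lemma linear_op0 : T 0 = 0.
Proof. by apply: (addrI (T 0)); rewrite -linear_opD !addr0. Qed.
Lemma linear_opZ a x : T (a *: x) = a *: T x.
Proof. by rewrite -[a *: x]addr0 lT linear_op0 addr0. Qed.
Lemma linear_opN x : T (- x) = - T x.
Proof. by rewrite -scaleN1r linear_opZ scaleN1r. Qed.
Lemma linear_opB x y : T (x - y) = T x - T y.
Proof. by rewrite linear_opD linear_opN. Qed.
End LinearOp.

Section ShiftModel.
Context {R : realType} {H : lmodType R[i]} (ip : H -> H -> R[i]).
Hypothesis ipP : inner_product ip.
Local Notation C := R[i].
(** An isometry [V] with adjoint [B] whose [1 - V B] is the projection onto the line of the unit
    vector [e]. This covers both [Mz] with the constant function [1] and the first component of an
    irreducible 2-finite pair. *)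
Variables (V B : H -> H) (e : H) (alpha : C).
Hypothesis adjVB : is_adjoint ip V B.
Hypothesis BV : forall x, B (V x) = x.
Hypothesis e1 : ip e e = 1.
Hypothesis dec : forall x, x - V (B x) = ip x e *: e.
Hypothesis alpha1 : `|alpha| = 1.

Local Notation W := (fun f => alpha^* *: V f).

Let linV : linear_op V. Proof. exact: adjoint_linear adjVB. Qed.
Let linB : linear_op B. Proof. exact: adjoint_linear (adjoint_sym ipP adjVB). Qed.
Let ipVV x y : ip (V x) (V y) = ip x y. Proof. by rewrite adjVB BV. Qed.

Let aac : alpha * alpha^* = 1. Proof. by rewrite -normCK alpha1 expr1n. Qed.
Let aca : alpha^* * alpha = 1. Proof. by rewrite mulrC aac. Qed.

Lemma shift_ip_cokernel x : ip (V x) e = 0.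
Proof.
have := dec (V x); rewrite BV subrr => /(congr1 (ip ^~ e)).
by rewrite (ip0l ipP) (ipZl ipP) e1 mulr1 => <-.
Qed.

Let ipeV x : ip e (V x) = 0. Proof. by rewrite (ipC ipP) shift_ip_cokernel conjC0. Qed.

Let adjV : adj ip V = B. Proof. exact: adjoint_eq. Qed.

Let adjVW : is_adjoint ip W (fun f => alpha *: B f).
Proof. by move=> x y; rewrite (ipZl ipP) (ipZr ipP) adjVB. Qed.

Let adjW : adj ip W = fun f => alpha *: B f. Proof. exact: adjoint_eq. Qed.

Let BW x : alpha *: B (alpha^* *: V x) = x.
Proof. by rewrite (linear_opZ linB) BV scalerA aac scale1r. Qed.

(** As [W] has adjoint [alpha B], the cross commutator is [alpha (1 - V B)]. *)
Lemma shift_crossE : cross_commutator ip V W = fun f => (alpha * ip f e) *: e.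
Proof.
apply: funext => f; rewrite /cross_commutator adjW BV (linear_opZ linV) -scalerBr.
by rewrite dec scalerA.
Qed.

(** The unimodular factors cancel and leave [(1 - V B) - V (1 - V B) B], the difference of the
    projections onto the orthogonal lines of [e] and [V e]. *)
Lemma shift_defectE :
  defect_op ip V W = fun f => ip f e *: e - ip f (V e) *: V e.
Proof.
apply: funext => f; rewrite /defect_op adjV adjW /=.
rewrite !(linear_opZ linB) !(linear_opZ linV) !scalerA aca !scale1r.
have -> : ip f (V e) = ip (B f) e by rewrite (ipC ipP) adjVB -(ipC ipP).
have <- : V (B f) - V (V (B (B f))) = ip (B f) e *: V e.
  by rewrite -(linear_opB linV) dec (linear_opZ linV).
by rewrite opprB -dec [V (V _) - _]addrC !addrA.
Qed.

Lemma shift_cross_rank : op_has_rank (cross_commutator ip V W) 1.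
Proof.
have nz : alpha != 0 by rewrite -normr_gt0 alpha1.
rewrite shift_crossE; exists (fun=> e); split=> [_|c|x].
- by exists (alpha^-1 *: e); rewrite (ipZl ipP) e1 mulr1 mulfV // scale1r.
- rewrite big_ord1 => /(congr1 (ip ^~ e)) h i; rewrite (ord1 i).
  by move: h; rewrite (ip0l ipP) (ipZl ipP) e1 mulr1.
- by exists (fun=> alpha * ip x e); rewrite big_ord1.
Qed.

Lemma shift_defect_rank : op_has_rank (defect_op ip V W) 2.
Proof.
rewrite shift_defectE; exists (fun i : 'I_2 => if i == ord0 then e else V e).
split=> [i|c|x].
- case: eqP => _.
    by exists e; rewrite e1 ipeV scale1r scale0r subr0.
  exists (- V e); rewrite !(ipNl ipP).
  by rewrite shift_ip_cokernel ipVV e1 oppr0 scale0r sub0r scaleN1r opprK.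
- rewrite !big_ord_recl big_ord0 /= addr0 => h i.
  have := congr1 (ip ^~ e) h; have := congr1 (ip ^~ (V e)) h.
  rewrite !(ipE ipP) shift_ip_cokernel ipVV ipeV e1 !mulr1 !mulr0 add0r addr0 => h1 h0.
  case: (unliftP ord0 i) => [j ->|-> //]; rewrite (ord1 j) //.
- exists (fun i : 'I_2 => if i == ord0 then ip x e else - ip x (V e)).
  by rewrite !big_ord_recl big_ord0 /= addr0 scaleNr.
Qed.

(** Pairing the eigenvalue equation with [e] and [V e] gives [<x,e> = l <x,e>] and
    [- <x,V e> = l <x,V e>]; if both coefficients vanish, then [l x = 0]. *)
Lemma shift_defect_eigenvalue l : l != 0 ->
  op_eigenvalue (defect_op ip V W) l <-> (l = 1 \/ l = -1).
Proof.
rewrite shift_defectE => l0; split=> [[x [x0 hx]]|[->|->]].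
- have := congr1 (ip ^~ e) hx; have := congr1 (ip ^~ (V e)) hx.
  rewrite !(ipE ipP) shift_ip_cokernel ipVV ipeV e1 !mulr1 !mulr0 sub0r subr0 => h1 h0.
  have [xe|nxe] := eqVneq (ip x e) 0; last first.
    by left; apply: (mulIf nxe); rewrite -h0 mul1r.
  have [xv|nxv] := eqVneq (ip x (V e)) 0; last first.
    by right; apply: (mulIf nxv); rewrite -h1 mulN1r.
  move/eqP: hx; rewrite xe xv !scale0r subrr eq_sym scaler_eq0.
  by rewrite (negPf l0) (negPf x0).
- exists e; rewrite e1 ipeV scale0r subr0; split=> //.
  by apply: contra_eq_neq e1 => ->; rewrite (ip0l ipP) eq_sym oner_eq0.
- exists (V e); rewrite shift_ip_cokernel ipVV e1 scale0r sub0r scale1r scaleN1r; split=> //.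
  have : ip (V e) (V e) = 1 by rewrite ipVV.
  by apply: contra_eq_neq => ->; rewrite (ip0l ipP) eq_sym oner_eq0.
Qed.

Let bessel f : `|ip f e| ^+ 2 <= ip f f.
Proof. by have := cauchy_schwarz ipP f e; rewrite e1 mulr1. Qed.

(** This family of operators contains both the cross commutator and its resolvents, so one estimate
    bounds them all. *)
Let linR a b : linear_op (fun f => a *: f + (b * ip f e) *: e).
Proof.
move=> c x y; rewrite !(ipE ipP) !scalerDr !scalerA addrACA -scalerDl.
by rewrite (mulrC c a) mulrDr (mulrCA b c).
Qed.

Let boundR a b : bounded_op ip (fun f => a *: f + (b * ip f e) *: e).
Proof.
apply: (@bounded_opP _ _ _ ipP _ (2 * `|a| ^+ 2 + 2 * `|b| ^+ 2)) => //.
  by rewrite addr_ge0 // mulr_ge0 // exprn_ge0.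
move=> x; apply: le_trans (ipD_le ipP _ _) _.
rewrite !(ipZZ ipP) e1 mulr1 [leRHS]mulrDl mulrA lerD2l normrM exprMn mulrA.
by rewrite -!mulrA !ler_wpM2l // exprn_ge0.
Qed.

Lemma shift_cross_bounded : bounded_op ip (cross_commutator ip V W).
Proof.
rewrite shift_crossE; have := boundR 0 alpha.
by under eq_fun do rewrite scale0r add0r.
Qed.

Lemma shift_cross_spectrum l :
  (op_spectrum ip (cross_commutator ip V W) l /\ l != 0) <-> l = alpha.
Proof.
rewrite shift_crossE; split=> [[h l0]|->]; last first.
  split; last by rewrite -normr_gt0 alpha1.
  (* [e] is an eigenvector for [alpha], so a linear left inverse would send [0] to [e]. *)
  case=> S [[lS _] /(_ e) [+ _]].
  rewrite e1 mulr1 subrr linear_op0 // => e0.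
  by move/eqP: e1; rewrite -e0 (ip0l ipP) eq_sym oner_eq0.
apply: contra_notP h => /eqP la.
have d0 : alpha - l != 0 by rewrite subr_eq0 eq_sym.
(* The resolvent acts as [(alpha - l)^-1] on the line of [e] and as [- l^-1] on its orthogonal
   complement. *)
exists (fun f => - l^-1 *: f + (((alpha - l)^-1 + l^-1) * ip f e) *: e).
split=> [|x]; first exact: boundR.
split.
  rewrite !(ipE ipP) e1 mulr1 scalerBr !scalerA [- l^-1 * l]mulNr mulVf // scaleN1r opprK.
  rewrite addrAC -scalerDl [X in X *: e + _](_ : _ = 0) ?scale0r ?add0r //.
  by field; rewrite ?d0 ?l0.
rewrite !(ipE ipP) e1 mulr1 scalerDr scalerA mulrN mulfV // scaleN1r scalerA opprD opprK.
rewrite addrCA -scalerBl [X in _ + X *: e](_ : _ = 0) ?scale0r ?addr0 //.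
by field; rewrite ?d0 ?l0.
Qed.

(** The image of [u n] is determined by the scalar [<u n, e>], which is bounded by Cauchy-Schwarz,
    so a scalar subsequence suffices. *)
Lemma shift_cross_compact : compact_op ip (cross_commutator ip V W).
Proof.
split; first exact: shift_cross_bounded.
rewrite shift_crossE => u [M hM].
have [|phi [inc [l hl]]] := @bolzano_weierstrass R (fun n => ip (u n) e) M.
  move=> n; apply: le_trans (norm_ip_le ipP _ _) _.
  by rewrite [X in _ * X]/nrm e1 sqrtC1 mulr1.
exists phi; split=> //; exists ((alpha * l) *: e) => eps e0.
have [N hN] := hl _ e0; exists N => n /hN lt.
rewrite (nrm_lt ipP) // -scalerBl -mulrBr (ipZZ ipP) e1 mulr1 normrM alpha1 mul1r.
by rewrite ltr_sqr ?nnegrE // ltW.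
Qed.

Lemma shift_cross_normal : normal_op ip (cross_commutator ip V W).
Proof.
split; first exact: shift_cross_bounded.
have -> : adj ip (cross_commutator ip V W) = fun f => (alpha^* * ip f e) *: e.
  rewrite shift_crossE; apply: adjoint_eq => // x y.
  by rewrite (ipZl ipP) (ipZr ipP) rmorphM /= conjCK -(ipC ipP y) mulrAC.
rewrite shift_crossE => x; congr (_ *: _); rewrite !(ipZl ipP) e1; ring.
Qed.

Lemma shift_isometry c : `|c| = 1 -> op_isometry ip (fun f => c *: V f).
Proof.
move=> c1; have cc : c^* * c = 1 by rewrite mulrC -normCK c1 expr1n.
split.
  apply: (@bounded_opP _ _ _ ipP _ 1) => // [a x y|x].
    by rewrite linV scalerDr !scalerA mulrC.
  by rewrite (ipZZ ipP) ipVV c1 expr1n.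
have -> : adj ip (fun f => c *: V f) = fun f => c^* *: B f.
  by apply: adjoint_eq => // x y; rewrite (ipZl ipP) (ipZr ipP) conjCK adjVB.
by move=> x; rewrite (linear_opZ linB) BV scalerA cc scale1r.
Qed.

(** * Pure shifts: the BCL property and irreducibility *)

Section Pure.
Hypothesis pure : forall x, cvg_to ip (fun m => iter m B x) 0.

Lemma shift_BCL_pair : BCL_pair ip V W.
Proof.
have a1 : `|alpha^*| = 1 by rewrite norm_conjC.
split.
  split=> [||x]; last by rewrite (linear_opZ linV).
    by have := shift_isometry (normr1 _); under eq_fun do rewrite scale1r.
  exact: shift_isometry.
have adjVW2 : adj ip (V \o W) = fun f => alpha *: B (B f).
  apply: adjoint_eq => // x y /=.
  by rewrite (linear_opZ linV) (ipZl ipP) (ipZr ipP) !adjVB.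
split.
  split; last by move=> x; rewrite adjVW2 /= BV BW.
  apply: (@bounded_opP _ _ _ ipP _ 1) => // [a x y|x] /=.
    by rewrite linV scalerDr (linear_opD linV) scalerA mulrC -scalerA (linear_opZ linV a).
  by rewrite ipVV (ipZZ ipP) ipVV a1 expr1n.
move=> x; rewrite adjVW2; apply/(cvg_to_clim ipP).
have inc n : (n.*2 < n.+1.*2)%N by rewrite ltn_double.
have /(cvg_to_clim ipP) h := pure x.
apply: clim_ext (clim_sub inc h) => n /=; rewrite !subr0.
(* Up to a unimodular factor, the iterates of the adjoint of [V W] are the even iterates of [B], a
   subsequence of one tending to [0]. *)
have -> : iter n (fun f => alpha *: B (B f)) x = alpha ^+ n *: iter n.*2 B x.
  elim: n => [|n IH]; first by rewrite scale1r.
  by rewrite doubleS !iterS IH !(linear_opZ linB) scalerA -exprS.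
by rewrite (ipZZ ipP) normrX alpha1 !expr1n mul1r.
Qed.

Lemma shift_two_finite : two_finite_pair ip V W.
Proof.
split; last exact: shift_defect_rank.
split; [exact: shift_BCL_pair|exact: shift_cross_compact|exact: shift_cross_normal].
Qed.

(** If a nonzero [f] of a reducing subspace had [<B^k f, e> = 0] for all [k], the norms [|B^k f|]
    would be constant, against purity. So some [B^k f] has a component along [e], and [dec] puts [e]
    in the subspace. Any [x] is then the limit of [x - V^n B^n x], a telescoping sum of multiples of
    [V^j e]. *)
Lemma shift_irreducible : irreducible_pair ip V W.
Proof.
move=> M [M0 Ml Mc] iV _; rewrite adjV => iB _.
have MZ a x : M x -> M (a *: x) by move=> Mx; rewrite -[a *: x]addr0; apply: Ml.
have MD x y : M x -> M y -> M (x + y) by move=> ? ?; rewrite -[x]scale1r; apply: Ml.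
have MN x : M x -> M (- x) by rewrite -scaleN1r; apply: MZ.
have [h|/existsNP [f /not_implyP [Mf /eqP f0]]] := pselect (forall x, M x -> x = 0).
  by left; apply/seteqP; split=> [x /h|x ->].
right; apply/seteqP; split=> // x _.
have [k hk] : exists k, ip (iter k B f) e != 0.
  apply: contrapT => /forallNP hk.
  have cst k : ip (iter k B f) (iter k B f) = ip f f.
    elim: k => //= k <-; set y := iter k B f.
    have := dec y; rewrite (_ : ip y e = 0) ?scale0r; last first.
      by have /negP := hk k; rewrite negbK => /eqP.
    by move/eqP; rewrite subr_eq0 => /eqP yV; rewrite -adjVB -yV.
  have /(cvg_to_clim ipP) h := pure f.
  case/eqP: f0; apply: (ip_eq0 ipP); apply: clim_unique h.
  by apply: (@clim_eventually _ _ _ 0%N) => n _; rewrite !subr0.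
have Miter T y n : (forall z, M z -> M (T z)) -> M y -> M (iter n T y).
  by move=> iT My; elim: n => //= n; apply: iT.
have Me : M e.
  set y := iter k B f in hk; have My : M y by exact: Miter.
  rewrite -[e]scale1r -(mulVf hk) -scalerA -dec; apply: MZ; apply: MD => //.
  by apply: MN; apply: iV; apply: iB.
have linVn n : linear_op (iter n V).
  by elim: n => [//|n IH] a y z; rewrite !iterS IH linV.
have isoVn n y : ip (iter n V y) (iter n V y) = ip y y.
  by elim: n => [//|n IH]; rewrite !iterS ipVV.
apply: (Mc (fun n => x - iter n V (iter n B x))) => [n|].
  elim: n => [|n IH]; first by rewrite subrr.
  rewrite iterSr iterS -[_ - _](subrKA (iter n V (iter n B x))).
  apply: MD => //; rewrite -(linear_opB (linVn n)) dec (linear_opZ (linVn n)).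
  by apply: MZ; apply: Miter.
apply/(cvg_to_clim ipP); have /(cvg_to_clim ipP) := pure x; apply: clim_ext => n.
by rewrite subr0 addrC addKr (ipNl ipP) (ipNr ipP) opprK isoVn.
Qed.

End Pure.

End ShiftModel.

(** * The Hardy space *)

Section Hardy.
Context {R : realType}.
Local Notation C := R[i].
Implicit Types f g h : H2 R.

Lemma h2D f g n : (f + g) n = f n + g n. Proof. by []. Qed.
Lemma h2Z (a : C) f n : (a *: f) n = a * f n. Proof. by []. Qed.
Lemma h2N f n : (- f) n = - f n. Proof. by []. Qed.
Lemma h2_ext f g : (forall n, f n = g n) -> f = g.
Proof. by move=> fg; apply: val_inj; apply: funext. Qed.

Lemma h2_sqsum f : sqsum f.
Proof. by case: f => f /= /asboolP. Qed.

Lemma sqsumK (a : nat -> C) : sqsum a -> h2coef (insubd (0 : H2 R) a) = a.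
Proof. by move=> h; rewrite insubdK //; apply/asboolP. Qed.

Lemma h2_sqsum_cvg f : exists l,
  clim (fun N => \sum_(n < N) f n * (f n)^*) l /\
  forall N, \sum_(n < N) f n * (f n)^* <= l.
Proof.
have [M hM] := h2_sqsum f; apply: (@clim_nondecreasing _ _ M) => N.
  by rewrite big_ord_recr lerDl -normCK exprn_ge0.
by under eq_bigr do rewrite -normCK.
Qed.

(** The value of [climit] is meaningful only for convergent sums; polarization reduces convergence
    to the monotone case [f = g]. *)
Lemma h2inner_clim f g : clim (fun N => \sum_(n < N) f n * (g n)^*) (h2inner f g).
Proof.
suff [l hl] : exists l, clim (fun N => \sum_(n < N) f n * (g n)^*) l.
  by rewrite /h2inner (climitE hl).
have [a [ha _]] := h2_sqsum_cvg (f + g).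
have [b [hb _]] := h2_sqsum_cvg (f + 'i *: g).
have [c [hc _]] := h2_sqsum_cvg f; have [d [hd _]] := h2_sqsum_cvg g.
(* Polarization: [2 f g^* = |f + g|^2 + i |f + i g|^2 - (1 + i) (|f|^2 + |g|^2)]. *)
exists (2^-1 * (a + 'i * b + (- (1 + 'i)) * (c + d))).
apply: clim_ext (climZ _ (climD (climD ha (climZ _ hb)) (climZ _ (climD hc hd)))) => N.
rewrite -big_split !mulr_sumr -!big_split mulr_sumr; apply: eq_bigr => n _; cbv beta.
rewrite !(h2D, h2Z) !(rmorphD, rmorphM) /= conjCi.
apply: (mulfI (_ : 2 != 0 :> C)); first by rewrite pnatr_eq0.
rewrite mulVKf ?pnatr_eq0 //; have := @sqrCi C; move: ('i : C) => j j2.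
(* A zero multiple of [j ^+ 2 + 1] is added so that [ring] can use [j ^+ 2 = -1]. *)
rewrite -[LHS]addr0 -[X in _ + X](mul0r (g n * (g n)^* * j + f n * (g n)^* - g n * (f n)^*)).
rewrite -(subrr (-1 : C)) -{1}j2; ring.
Qed.

Lemma h2inner_product : inner_product (@h2inner R).
Proof.
split=> [a f g h|f g|f].
- apply: climitE; apply: clim_ext (climD (climZ a (h2inner_clim f h)) (h2inner_clim g h)) => N.
  by rewrite mulr_sumr -big_split; apply: eq_bigr => n _ /=; rewrite mulrDl mulrA.
- apply: climitE; apply: clim_ext (clim_conj (h2inner_clim f g)) => N.
  by rewrite rmorph_sum; apply: eq_bigr => n _ /=; rewrite rmorphM /= conjCK mulrC.
have [l [hl le]] := h2_sqsum_cvg f.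
rewrite (_ : h2inner f f = l); last exact: climitE.
split=> [|l0]; first by have := le 0%N; rewrite big_ord0.
apply: h2_ext => n; apply/eqP; rewrite -normr_eq0 -sqrf_eq0.
rewrite eq_le exprn_ge0 // andbT -l0; apply: le_trans (le n.+1).
rewrite big_ord_recr /= -normCK lerDr sumr_ge0 // => i _.
by rewrite -normCK exprn_ge0.
Qed.

(** The default value of [insubd] in [Mz] is never taken: shifting preserves square summability. *)
Lemma MzE f : Mz f =1 coef_shift f.
Proof.
move=> n; rewrite /Mz sqsumK //; have [M hM] := h2_sqsum f.
exists M => -[|N]; first by have := hM 0%N; rewrite !big_ord0.
by rewrite big_ord_recl /= normr0 expr0n add0r; exact: hM.
Qed.

Definition back_shift f : H2 R := insubd (0 : H2 R) (fun n => f n.+1).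

Lemma back_shiftE f n : back_shift f n = f n.+1.
Proof.
rewrite /back_shift sqsumK //; have [M hM] := h2_sqsum f.
exists M => N; apply: le_trans (hM N.+1).
by rewrite big_ord_recl lerDr exprn_ge0.
Qed.

Definition h2_one : H2 R := insubd (0 : H2 R) (fun n => (n == 0)%:R).

Lemma h2_oneE n : h2_one n = (n == 0)%:R.
Proof.
rewrite /h2_one sqsumK //; exists 1 => -[|N]; first by rewrite big_ord0.
by rewrite big_ord_recl big1 /= ?normr1 ?expr1n ?addr0 // => i _; rewrite normr0 expr0n.
Qed.

Lemma h2inner_one f : h2inner f h2_one = f 0%N.
Proof.
apply: climitE; apply: (@clim_eventually _ _ _ 1%N) => -[|N] // _.
rewrite big_ord_recl h2_oneE rmorph1 mulr1 big1 ?addr0 // => i _.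
by rewrite h2_oneE /= rmorph0 mulr0.
Qed.

(** The partial sums of [<Mz f, g>] are those of [<f, back_shift g>] delayed by one index, which
    leaves [climit] unchanged. *)
Lemma Mz_adjoint : is_adjoint (@h2inner R) (@Mz R) back_shift.
Proof.
move=> f g; rewrite /h2inner -climit_shift; congr climit; apply: funext => N.
rewrite big_ord_recl MzE mul0r add0r; apply: eq_bigr => n _ /=.
by rewrite MzE back_shiftE.
Qed.

Lemma back_shiftK f : back_shift (Mz f) = f.
Proof. by apply: h2_ext => n; rewrite back_shiftE MzE. Qed.

Lemma Mz_decomposition f : f - Mz (back_shift f) = h2inner f h2_one *: h2_one.
Proof.
apply: h2_ext => n; rewrite h2D h2N h2Z h2inner_one h2_oneE MzE.
by case: n => [|n] /=; rewrite ?back_shiftE ?subr0 ?mulr1 // subrr mulr0.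
Qed.

(** The square norm of the [m]-th iterate is the tail, from index [m] on, of the convergent series
    for [<f, f>]. *)
Lemma back_shift_pure f : cvg_to (@h2inner R) (fun m => iter m back_shift f) 0.
Proof.
apply/(cvg_to_clim h2inner_product).
have coef m n : iter m back_shift f n = f (m + n)%N.
  by elim: m n => [//|m IH] n; rewrite iterS back_shiftE IH addnS.
have step m : h2inner (iter m back_shift f) (iter m back_shift f) =
    h2inner f f - \sum_(n < m) f n * (f n)^*.
  apply: climitE; elim: m => [|m IH].
    by rewrite big_ord0 subr0; apply: h2inner_clim.
  have {}IH := (clim_shift _ _).2 IH.
  have := climD IH (@clim_eventually _ (fun=> - (f m * (f m)^*)) _ 0%N (fun _ _ => erefl)).
  rewrite big_ord_recr /= opprD addrA; apply: clim_ext => N.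
  rewrite big_ord_recl coef addn0 addrAC subrr add0r.
  by apply: eq_bigr => n _; rewrite back_shiftE.
have cst := @clim_eventually _ (fun=> h2inner f f) _ 0%N (fun _ _ => erefl).
have := climD cst (climZ (-1) (h2inner_clim f f)); rewrite mulN1r subrr.
by apply: clim_ext => m; rewrite mulN1r -step subr0.
Qed.

End Hardy.

(** * Orthonormal bases and rank two operators *)

Section OrthonormalBasis.
Context {R : realType} {H : lmodType R[i]} (ip : H -> H -> R[i]).
Hypothesis ipP : inner_product ip.
Hypothesis complete : forall u : nat -> H, cauchy_seq ip u -> exists l, cvg_to ip u l.
Local Notation C := R[i].
Variable E : nat -> H.
Hypothesis orthonormal : forall m n, ip (E m) (E n) = (m == n)%:R.
Hypothesis total : forall y, (forall n, ip y (E n) = 0) -> y = 0.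

Definition onb_sum (a : nat -> C) N := \sum_(n < N) a n *: E n.

Lemma ip_onb_sum a N k : ip (onb_sum a N) (E k) = if (k < N)%N then a k else 0.
Proof.
rewrite /onb_sum; elim: N => [|N IH]; first by rewrite big_ord0 (ip0l ipP).
rewrite big_ord_recr /= (ipDl ipP) IH (ipZl ipP) orthonormal.
rewrite [(k < N.+1)%N]ltnS [(k <= N)%N]leq_eqVlt.
case: (ltngtP k N) => [_|_|->] /=; rewrite ?mulr0 ?addr0 //.
by rewrite add0r mulr1.
Qed.

Lemma ip_onb_suml a N y : ip (onb_sum a N) y = \sum_(n < N) a n * (ip y (E n))^*.
Proof.
rewrite (ip_suml ipP); apply: eq_bigr => n _.
by rewrite (ipZl ipP) -(ipC ipP).
Qed.

Lemma ip_onb_sum2 a m n : (m <= n)%N ->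
  ip (onb_sum a m) (onb_sum a n) = \sum_(k < m) a k * (a k)^*.
Proof.
move=> mn; rewrite ip_onb_suml; apply: eq_bigr => k _.
by rewrite ip_onb_sum (leq_trans (ltn_ord k) mn).
Qed.

(** Riesz-Fischer: by orthonormality the distance of two partial sums is governed by a tail of the
    series of [|f n|^2]. *)
Lemma onb_sum_cvg (f : H2 R) : exists2 y, cvg_to ip (onb_sum f) y & forall n, ip y (E n) = f n.
Proof.
have [l [hl le]] := h2_sqsum_cvg f.
pose T N := \sum_(n < N) f n * (f n)^*.
have real N : (T N)^* = T N.
  by rewrite rmorph_sum; apply: eq_bigr => n _; rewrite rmorphM /= conjCK mulrC.
have [||y hy] := cauchy_cvg ipP complete (u := onb_sum f) (eps := fun m => l - T m).
- have cst := @clim_eventually _ (fun=> l) _ 0%N (fun _ _ => erefl).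
  have := climD cst (climZ (-1) hl); rewrite mulN1r subrr.
  by apply: clim_ext => m; rewrite mulN1r.
- move=> m n mn; rewrite !(ipE ipP) (ipC ipP (onb_sum f m) (onb_sum f n)).
  rewrite !ip_onb_sum2 // -/(T m) -/(T n) real.
  by rewrite [leLHS](_ : _ = T n - T m) ?lerD2r ?le //; ring.
exists y => // n; apply: clim_unique (cvg_to_ip ipP (E n) hy) _.
by apply: (@clim_eventually _ _ _ n.+1) => N nN; rewrite ip_onb_sum nN.
Qed.

Definition onb_coef (y : H) : H2 R := insubd (0 : H2 R) (fun n => ip y (E n)).

(** Bessel's inequality makes the coefficients square summable, so [insubd] keeps them. *)
Lemma onb_coefE y n : onb_coef y n = ip y (E n).
Proof.
rewrite /onb_coef sqsumK //; exists (ip y y) => N.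
under eq_bigr do rewrite normCK.
set a := fun n => ip y (E n); have h := ip_onb_suml a N y.
have sym : ip y (onb_sum a N) = ip (onb_sum a N) y.
  rewrite (ipC ipP) h rmorph_sum.
  by apply: eq_bigr => k _; rewrite rmorphM /= conjCK mulrC.
rewrite -h -subr_ge0; have := ip_ge0 ipP (y - onb_sum a N).
rewrite !(ipE ipP) ip_onb_sum2 // -h sym.
by rewrite [leRHS](_ : _ = ip y y - ip (onb_sum a N) y) //; ring.
Qed.

Lemma onb_coef_cvg y : cvg_to ip (onb_sum (onb_coef y)) y.
Proof.
have [z hz zE] := onb_sum_cvg (onb_coef y).
suff zy : z = y by rewrite zy in hz.
apply/eqP; rewrite -subr_eq0; apply/eqP; apply: total => n.
by rewrite (ipDl ipP) (ipNl ipP) zE onb_coefE subrr.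
Qed.

Lemma onb_coef_linear (a : C) x y : onb_coef (a *: x + y) = a *: onb_coef x + onb_coef y.
Proof.
by apply: h2_ext => n; rewrite h2D h2Z !onb_coefE (ipDl ipP) (ipZl ipP).
Qed.

Lemma onb_coef_surj f : exists y, onb_coef y = f.
Proof.
have [y _ hy] := onb_sum_cvg f; exists y.
by apply: h2_ext => n; rewrite onb_coefE hy.
Qed.

Lemma onb_coef_isometry x y : h2inner (onb_coef x) (onb_coef y) = ip x y.
Proof.
apply: climitE; apply: clim_ext (cvg_to_ip ipP y (onb_coef_cvg x)) => N.
by rewrite ip_onb_suml; apply: eq_bigr => n _; rewrite (onb_coefE y).
Qed.

End OrthonormalBasis.

(** Nonzero orthogonal vectors are independent, so two of them in a two-dimensional range form a
    basis of it. *)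
Lemma rank2_span {R : realType} {H : lmodType R[i]} (ip : H -> H -> R[i]) (T : H -> H) u v :
  inner_product ip -> op_has_rank T 2 -> (exists x, T x = u) -> (exists x, T x = v) ->
  u != 0 -> v != 0 -> ip u v = 0 -> forall x, exists a b, T x = a *: u + b *: v.
Proof.
move=> ipP [g [_ _ hg]] [xu <-] [xv <-] u0 v0 uv x.
have hg2 y : exists p q, T y = p *: g ord0 + q *: g (lift ord0 ord0).
  have [c ->] := hg y; exists (c ord0), (c (lift ord0 ord0)).
  by rewrite !big_ord_recl big_ord0 addr0.
move: (g ord0) (g (lift ord0 ord0)) hg2 => {hg} g0 g1 hg.
have [c0 [c1 hu]] := hg xu; have [d0 [d1 hv]] := hg xv; have [p [q hx]] := hg x.
have [det|det] := eqVneq (c0 * d1 - c1 * d0) 0; last first.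
  (* Cramer's rule in the basis [g0], [g1]. *)
  exists ((c0 * d1 - c1 * d0)^-1 * (p * d1 - q * d0)).
  exists ((c0 * d1 - c1 * d0)^-1 * (c0 * q - c1 * p)).
  apply: (scalerI det); rewrite scalerDr !scalerA !(mulrA _ _^-1) mulfV // !mul1r hu hv hx.
  rewrite !scalerDr !scalerA addrACA -!scalerDl.
  by congr (_ *: _ + _ *: _); ring.
have dep s t : s * c0 + t * d0 = 0 -> s * c1 + t * d1 = 0 -> s = 0 /\ t = 0.
  move=> h0 h1; have z : s *: T xu + t *: T xv = 0.
    by rewrite hu hv !scalerDr !scalerA addrACA -!scalerDl h0 h1 !scale0r addr0.
  have /eqP := congr1 (ip ^~ (T xu)) z; have /eqP := congr1 (ip ^~ (T xv)) z.
  rewrite !(ipE ipP) uv (ipC ipP (T xu) (T xv)) uv conjC0 !mulr0 add0r addr0 !mulf_eq0.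
  by rewrite !(gt_eqF (ip_gt0 ipP _)) // !orbF => /eqP -> /eqP ->.
(* A vanishing determinant makes [(d0, - c0)] and [(d1, - c1)] linear relations between the two
   vectors; both must be trivial, which annuls [v]. *)
have [||d00 c00] := dep d0 (- c0); [ring|by rewrite -[RHS]oppr0 -det; ring|].
have [||d10 c10] := dep d1 (- c1); [by rewrite -[RHS]det; ring|ring|].
by move: v0; rewrite hv d00 d10 !scale0r addr0 eqxx.
Qed.

(** * Irreducible 2-finite pairs *)

Section CommutingIsometries.
Context {R : realType} {H : lmodType R[i]} (ip : H -> H -> R[i]).
Hypothesis ipP : inner_product ip.
Local Notation C := R[i].
Variables V1 V2 A1 A2 : H -> H.
Hypothesis adj1 : is_adjoint ip V1 A1.
Hypothesis adj2 : is_adjoint ip V2 A2.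
Hypothesis AV1 : forall x, A1 (V1 x) = x.
Hypothesis AV2 : forall x, A2 (V2 x) = x.
Hypothesis V12 : forall x, V1 (V2 x) = V2 (V1 x).
Hypothesis irred : irreducible_pair ip V1 V2.
Hypothesis rank2 : op_has_rank (defect_op ip V1 V2) 2.

Local Notation K := (fun x => A2 (V1 x) - V1 (A2 x)).
Local Notation K' := (fun x => A1 (V2 x) - V2 (A1 x)).
Local Notation D := (fun x => x - V1 (A1 x) - V2 (A2 x) + V1 (V2 (A1 (A2 x)))).

Let adjE1 : adj ip V1 = A1. Proof. exact: adjoint_eq. Qed.
Let adjE2 : adj ip V2 = A2. Proof. exact: adjoint_eq. Qed.
Let adjs1 : is_adjoint ip A1 V1. Proof. exact: adjoint_sym. Qed.
Let adjs2 : is_adjoint ip A2 V2. Proof. exact: adjoint_sym. Qed.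
Let lV1 : linear_op V1. Proof. exact: adjoint_linear adj1. Qed.
Let lV2 : linear_op V2. Proof. exact: adjoint_linear adj2. Qed.
Let lA1 : linear_op A1. Proof. exact: adjoint_linear adjs1. Qed.
Let lA2 : linear_op A2. Proof. exact: adjoint_linear adjs2. Qed.
Let A12 x : A1 (A2 x) = A2 (A1 x).
Proof. by apply: (ip_inj ipP) => z; rewrite -!(adj1, adj2) V12. Qed.
Let ip11 x y : ip (V1 x) (V1 y) = ip x y. Proof. by rewrite adj1 AV1. Qed.
Let ip22 x y : ip (V2 x) (V2 y) = ip x y. Proof. by rewrite adj2 AV2. Qed.
Let rankD : op_has_rank D 2.
Proof. by move: rank2; rewrite /defect_op adjE1 adjE2. Qed.

Lemma cross_adjoint : is_adjoint ip K K'.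
Proof.
move=> x y.
by rewrite (ipDl ipP) (ipDr ipP) (ipNl ipP) (ipNr ipP) adj1 adjs2 adjs2 adj1.
Qed.

(** Carried across the inner product, the hypothesis says that the orthogonal complement of [F] is
    invariant under all four operators; irreducibility leaves it [0] or everything. *)
Lemma reducing_orthogonal (F : set H) :
  (forall x, F x -> forall y, (forall z, F z -> ip y z = 0) ->
     [/\ ip y (V1 x) = 0, ip y (V2 x) = 0, ip y (A1 x) = 0 & ip y (A2 x) = 0]) ->
  (forall y, (forall z, F z -> ip y z = 0) -> y = 0) \/
  (forall y z, F z -> ip y z = 0).
Proof.
move=> hF; pose M := [set y | forall z, F z -> ip y z = 0].
have [||||M0|MT] := irred (orthogonal_closed ipP F).
- by move=> y My z Fz; rewrite adj1; case: (hF z Fz y My).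
- by move=> y My z Fz; rewrite adj2; case: (hF z Fz y My).
- by rewrite adjE1 => y My z Fz; rewrite adjs1; case: (hF z Fz y My).
- by rewrite adjE2 => y My z Fz; rewrite adjs2; case: (hF z Fz y My).
- left=> y hy; have : M y by [].
  by rewrite /M M0.
- by right=> y; have : M y by rewrite /M MT.
Qed.

(** If [K = 0], each isometry commutes with the adjoint of the other, so [D] maps into the joint
    kernel of [A1] and [A2]. For orthogonal nonzero [e], [f] there, the vectors [V1^m V2^n e]
    generate a reducing subspace orthogonal to [f]. *)
Lemma cross_neq0 : ~ (forall x, K x = 0).
Proof.
move=> K0; have VA x : A2 (V1 x) = V1 (A2 x) by apply/eqP; rewrite -subr_eq0 K0.
have VA' x : A1 (V2 x) = V2 (A1 x).
  apply: (ip_inj ipP) => z.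
  by rewrite -adj1 -adjs2 VA adj1 adjs2.
have AD x : A1 (D x) = 0 /\ A2 (D x) = 0.
  split.
    rewrite (linear_opD lA1) !(linear_opB lA1) AV1 subrr sub0r AV1 VA' A12.
    by rewrite addNr.
  rewrite (linear_opD lA2) !(linear_opB lA2) AV2 V12 AV2 VA A12.
  by rewrite [X in X + _]addrAC subrr sub0r addNr.
have [g [gD gfree _]] := rankD.
have free2 p q : p *: g ord0 + q *: g (lift ord0 ord0) = 0 -> p = 0 /\ q = 0.
  move=> h; have := gfree (fun i => if i == ord0 then p else q).
  rewrite !big_ord_recl big_ord0 addr0 /= h => /(_ erefl) c.
  by split; [apply: (c ord0)|apply: (c (lift ord0 ord0))].
have gA i : A1 (g i) = 0 /\ A2 (g i) = 0 by have [x <-] := gD i; exact: AD.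
move: (g ord0) (g (lift ord0 ord0)) (gA ord0) (gA (lift ord0 ord0)) free2.
move=> e g1 [Ae1 Ae2] [Ag1 Ag2] free2.
have e0 : e != 0.
  apply/eqP => e0; have [] := free2 1 0; first by rewrite e0 scaler0 scale0r addr0.
  by move/eqP; rewrite oner_eq0.
(* Gram-Schmidt, scaled by [<e,e>] to avoid a division. *)
pose f := ip e e *: g1 - ip g1 e *: e.
have f0 : f != 0.
  apply/eqP => h; have [] := free2 (- ip g1 e) (ip e e).
    by rewrite addrC scaleNr.
  by move=> _ /(ip_eq0 ipP)/eqP; rewrite (negPf e0).
have fe : ip f e = 0 by rewrite !(ipE ipP) mulrC subrr.
have Af1 : A1 f = 0 by rewrite (linear_opB lA1) !(linear_opZ lA1) Ae1 Ag1 !scaler0 subrr.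
have Af2 : A2 f = 0 by rewrite (linear_opB lA2) !(linear_opZ lA2) Ae2 Ag2 !scaler0 subrr.
pose E m n := iter m V1 (iter n V2 e).
have V2E m n : V2 (E m n) = E m n.+1.
  by rewrite /E; elim: m => //= m <-; rewrite V12.
have A2E m n : A2 (E m n) = if n is k.+1 then E m k else 0.
  rewrite /E; elim: m => [|m IH] /=; first by case: n => [|n] /=; rewrite ?AV2.
  by rewrite VA IH; case: n {IH} => [|n] //; rewrite linear_op0.
have A1E m n : A1 (E m n) = if m is k.+1 then E k n else 0.
  case: m => [|m]; last by rewrite /E /= AV1.
  by rewrite /E /=; elim: n => //= n IH; rewrite VA' IH linear_op0.
have [|h|h] := @reducing_orthogonal [set z | exists m n, z = E m n].
- move=> _ [m [n ->]] y hy; have {}hy p q : ip y (E p q) = 0 by apply: hy; exists p, q.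
  rewrite V2E A1E A2E -[V1 _]/(E m.+1 n).
  by split=> //; [case: m|case: n] => *; rewrite ?(ip0r ipP).
- move/eqP: f0; apply; apply: h => _ [m [n ->]]; rewrite /E.
  case: m => [|m]; last by rewrite iterS -adjs1 Af1 (ip0l ipP).
  by case: n => [//|n]; rewrite /= -adjs2 Af2 (ip0l ipP).
by move/eqP: e0; apply; apply: (ip_eq0 ipP); apply: h; exists 0%N, 0%N.
Qed.

Hypothesis Knormal : forall x, K (K' x) = K' (K x).

Lemma cross_eigenvector : exists x beta,
  [/\ ip x x = 1, A1 x = 0, A2 x = 0, `|beta| = 1 & V1 x = beta *: V2 x].
Proof.
(* Normality gives [K] and [K'] the same kernel. It contains the ranges of both isometries, since
   [K] kills that of [V2] and [K'] that of [V1]; dually, the ranges of [K] and [K'] lie in the joint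
   kernel of [A1] and [A2]. *)
have KK' x : ip (K x) (K x) = ip (K' x) (K' x).
  by rewrite cross_adjoint -Knormal -(adjoint_sym ipP cross_adjoint).
have KV2 x : K (V2 x) = 0 by rewrite /= AV2 V12 AV2 subrr.
have K'V1 x : K' (V1 x) = 0 by rewrite /= AV1 -V12 AV1 subrr.
have K'V2 x : K' (V2 x) = 0 by apply: (ip_eq0 ipP); rewrite -KK' KV2 (ip0l ipP).
have KV1 x : K (V1 x) = 0 by apply: (ip_eq0 ipP); rewrite KK' K'V1 (ip0l ipP).
have adjK' := adjoint_sym ipP cross_adjoint.
have A1K x : A1 (K x) = 0.
  by apply: (ip_inj ipP) => z; rewrite -adj1 -adjK' K'V1 (ip0l ipP) (ip0r ipP).
have A2K x : A2 (K x) = 0.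
  by apply: (ip_inj ipP) => z; rewrite -adj2 -adjK' K'V2 (ip0l ipP) (ip0r ipP).
have A1K' x : A1 (K' x) = 0.
  by apply: (ip_inj ipP) => z; rewrite -adj1 -cross_adjoint KV1 (ip0l ipP) (ip0r ipP).
have A2K' x : A2 (K' x) = 0.
  by apply: (ip_inj ipP) => z; rewrite -adj2 -cross_adjoint KV2 (ip0l ipP) (ip0r ipP).
have [w Kw] : exists w, K w != 0.
  apply: contrapT => /forallNP h; apply: cross_neq0 => x.
  by apply: contrapT => /eqP; apply: h.
(* A normal operator vanishing on [K w] also has [K' (K w) = 0], hence [<K w, K w> = 0]. So the
   normalized [K w] is a vector [x] with [K x] nonzero. *)
have KKw : K (K w) != 0.
  apply: contra Kw => /eqP h; apply/eqP/(ip_eq0 ipP).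
  have : K' (K w) = 0 by apply: (ip_eq0 ipP); rewrite -KK' h (ip0l ipP).
  by move=> h'; rewrite cross_adjoint h' (ip0r ipP).
have lK : linear_op K by exact: adjoint_linear cross_adjoint.
have [x [x1 Ax1 Ax2 Kx0]] : exists x, [/\ ip x x = 1, A1 x = 0, A2 x = 0 & K x != 0].
  have p := ip_gt0 ipP Kw.
  have c0 : (sqrtC (ip (K w) (K w)))^-1 != 0 by rewrite invr_eq0 sqrtC_eq0 gt_eqF.
  exists ((sqrtC (ip (K w) (K w)))^-1 *: K w); split.
  - rewrite (ipZZ ipP) normfV ger0_norm ?sqrtC_ge0 ?ltW // exprVn sqrtCK mulVf //.
    by rewrite gt_eqF.
  - by rewrite (linear_opZ lA1) A1K scaler0.
  - by rewrite (linear_opZ lA2) A2K scaler0.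
  - by rewrite (linear_opZ lK) scaler_eq0 (negPf c0).
have DE y : A1 y = 0 -> A2 y = 0 -> D y = y.
  move=> h1 h2; rewrite h1 h2 (linear_op0 lA1) (linear_op0 lV2) !(linear_op0 lV1).
  by rewrite !subr0 addr0.
have KE : K x = A2 (V1 x) by rewrite Ax2 (linear_op0 lV1) subr0.
have K'E : K' x = A1 (V2 x) by rewrite Ax1 (linear_op0 lV2) subr0.
have DV1 : D (V1 x) = - V2 (K x).
  have A1A2 : A1 (A2 (V1 x)) = 0 by rewrite -KE A1K.
  by rewrite KE A1A2 AV1 subrr sub0r (linear_op0 lV2) (linear_op0 lV1) addr0.
have DV2 : D (V2 x) = - V1 (K' x).
  rewrite K'E AV2 Ax1 (linear_op0 lV2) (linear_op0 lV1) addr0 addrAC subrr.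
  by rewrite sub0r.
have x0 : x != 0.
  by apply: contra_eq_neq x1 => ->; rewrite (ip0l ipP) eq_sym oner_eq0.
have v0 : V2 (K x) != 0.
  by apply: contra Kx0 => /eqP h; apply/eqP/(ip_eq0 ipP); rewrite -ip22 h (ip0l ipP).
(* Here the rank condition enters: [x = D x] and [- V2 (K x) = D (V1 x)] are nonzero and
   orthogonal. *)
have span y : exists a b, D y = a *: x + b *: V2 (K x).
  have [|||||a [b ->]] := @rank2_span _ _ _ D x (- V2 (K x)) ipP rankD _ _ _ _ _ y => //.
  - by exists x; exact: DE.
  - by exists (V1 x).
  - by rewrite oppr_eq0.
  - by rewrite (ipNr ipP) -adjs2 Ax2 (ip0l ipP) oppr0.
  - by exists a, (- b); rewrite scalerN scaleNr.
(* A vector killed by [A2] is orthogonal to [V2 (K x)], so only its [x] component survives: the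
   joint kernel is a line. *)
have spanE y : A1 y = 0 -> A2 y = 0 -> exists a, y = a *: x.
  move=> h1 h2; have [a [b]] := span y; rewrite DE // => h; exists a.
  pose k := K x; have {}h : y = a *: x + b *: V2 k by [].
  have k0 : k != 0 by [].
  have := congr1 (ip ^~ (V2 k)) h.
  rewrite (ipDl ipP) !(ipZl ipP) -!adjs2 h2 Ax2 !(ip0l ipP) mulr0 add0r AV2 => /esym/eqP.
  rewrite mulf_eq0 (gt_eqF (ip_gt0 ipP k0)) orbF => /eqP b0.
  by rewrite h b0 scale0r addr0.
have [a Ka] := spanE _ (A1K x) (A2K x).
have [a' Ka'] := spanE _ (A1K' x) (A2K' x).
have a0 : a != 0 by apply: contra Kx0 => /eqP a0; rewrite Ka a0 scale0r.
have a'0 : a' != 0.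
  apply: contra a0 => /eqP h; rewrite -[a]mulr1 -x1 -(ipZl ipP) -Ka cross_adjoint.
  by rewrite Ka' h scale0r (ip0r ipP).
(* Expanding [D (V2 x) = - V1 (K' x)] gives [- a' V1 x = p x + q a V2 x]; pairing with [x] kills
   [p], and dividing by [a'] yields the proportionality constant. It is unimodular because both
   operators are isometric. *)
have [p [q]] := span (V2 x); rewrite DV2 => h.
have p0 : p = 0.
  have := congr1 (ip ^~ x) h; rewrite (ipNl ipP) (ipDl ipP) !(ipZl ipP) adj1 adj2.
  by rewrite Ax1 Ax2 !(ip0r ipP) mulr0 oppr0 addr0 x1 mulr1.
have V1x : V1 x = (- (a'^-1 * (q * a))) *: V2 x.
  have : a' *: V1 x = (- (q * a)) *: V2 x.
    rewrite -(linear_opZ lV1) -Ka' -[V1 _]opprK h p0 scale0r add0r Ka.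
    by rewrite (linear_opZ lV2) scalerA scaleNr.
  by move/(congr1 (fun z => a'^-1 *: z)); rewrite !scalerA mulVf // scale1r mulrN.
exists x, (- (a'^-1 * (q * a))); split=> //.
have := ip11 x x; rewrite {1 2}V1x (ipZZ ipP) ip22 x1 mulr1 => /eqP.
by rewrite sqrp_eq1 // => /eqP.
Qed.

Lemma pair_shift_model : exists x beta,
  [/\ `|beta| = 1, ip x x = 1, (forall y, y - V1 (A1 y) = ip y x *: x),
      V2 = (fun y => beta^* *: V1 y) &
      (forall m n, ip (iter m V1 x) (iter n V1 x) = (m == n)%:R) /\
      (forall y, (forall n, ip y (iter n V1 x) = 0) -> y = 0)].
Proof.
have [x [beta [x1 Ax1 Ax2 b1 V1x]]] := cross_eigenvector.
have bb : beta^* * beta = 1 by rewrite mulrC -normCK b1 expr1n.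
have V2x : V2 x = beta^* *: V1 x by rewrite V1x scalerA bb scale1r.
pose E n := iter n V1 x; have E0 : E 0%N = x by [].
have V2E n : V2 (E n) = beta^* *: E n.+1.
  by rewrite /E; elim: n => [//|n IH]; rewrite iterS -V12 IH (linear_opZ lV1).
have A1E n : A1 (E n.+1) = E n by rewrite /E /= AV1.
have A2E n : A2 (E n.+1) = beta *: E n.
  have -> : E n.+1 = beta *: V2 (E n) by rewrite V2E scalerA mulrC bb scale1r.
  by rewrite (linear_opZ lA2) AV2.
have total y : (forall n, ip y (E n) = 0) -> y = 0.
  (* The four operators send each [E n] to a multiple of some [E k] or to [0]. *)
  have [||h] := @reducing_orthogonal (range E).
  - move=> _ [n _ <-] z hz; have {}hz k : ip z (E k) = 0 by apply: hz; exists k.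
    split; [exact: (hz n.+1)|by rewrite V2E (ipZr ipP) hz mulr0| |].
      by case: n => [|n]; rewrite ?A1E // Ax1 (ip0r ipP).
    by case: n => [|n]; rewrite ?A2E ?(ipZr ipP) ?hz ?mulr0 // Ax2 (ip0r ipP).
  - by move=> h hy; apply: h => _ [n _ <-].
  have : ip x x = 0 by apply: h; exists 0%N.
  by rewrite x1 => /eqP; rewrite oner_eq0.
(* By totality, both operator identities need only be tested against the vectors [E n]. *)
exists x, beta; split=> //.
- move=> y; apply/eqP; rewrite -subr_eq0; apply/eqP/total => n.
  rewrite !(ipE ipP) adj1; case: n => [|n].
    by rewrite E0 Ax1 (ip0r ipP) subr0 x1 mulr1 subrr.
  by rewrite A1E -[E n.+1]/(V1 (E n)) -!adjs1 Ax1 (ip0l ipP) mulr0 subr0 subrr.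
- apply: funext => y; apply/eqP; rewrite -subr_eq0; apply/eqP/total => n.
  rewrite (ipDl ipP) (ipNl ipP) (ipZl ipP) adj1 adj2; case: n => [|n].
    by rewrite E0 Ax1 Ax2 (ip0r ipP) mulr0 subrr.
  by rewrite A1E A2E (ipZr ipP) subrr.
split=> // m n; elim: m n => [|m IH] [|n] //=.
- by rewrite -adjs1 Ax1 (ip0l ipP).
- by rewrite adj1 Ax1 (ip0r ipP).
- by rewrite ip11 IH.
Qed.

End CommutingIsometries.

(** * Classification of irreducible 2-finite pairs *)

Theorem theorem6p3 (R : realType) :
  (forall (H : lmodType R[i]) (ip : H -> H -> R[i]) (V1 V2 : H -> H),
      is_hilbert ip ->
      irreducible_pair ip V1 V2 ->
      two_finite_pair ip V1 V2 ->
      [/\ (forall l : R[i], l != 0 ->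
             (op_eigenvalue (defect_op ip V1 V2) l <-> (l = 1 \/ l = -1))),
          op_has_rank (cross_commutator ip V1 V2) 1
        & exists alpha : R[i],
            [/\ `|alpha| = 1,
                (forall l : R[i],
                   (op_spectrum ip (cross_commutator ip V1 V2) l /\ l != 0) <-> l = alpha)
              & unitarily_equivalent ip (@h2inner R) V1 V2
                  (@Mz R) (fun f => alpha^* *: Mz f)]]) /\
  (forall alpha : R[i], `|alpha| = 1 ->
      [/\ irreducible_pair (@h2inner R) (@Mz R) (fun f => alpha^* *: Mz f),
          two_finite_pair (@h2inner R) (@Mz R) (fun f => alpha^* *: Mz f)
        & (forall l : R[i], l != 0 ->
             (op_eigenvalue (defect_op (@h2inner R) (@Mz R) (fun f => alpha^* *: Mz f)) l
                <-> (l = 1 \/ l = -1)))]).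

Proof.
split=> [H ip V1 V2 [lin herm pos complete _] irr [[BCL _ nK] rank2]|alpha a1].
  have ipP : inner_product ip by [].
  case: BCL => -[[b1 AV1] [b2 AV2] V12] _.
  have adj1 := adjointP ipP complete b1; have adj2 := adjointP ipP complete b2.
  (* The adjoint of the cross commutator is the cross commutator of the exchanged pair. *)
  have Knormal : forall x, cross_commutator ip V1 V2 (cross_commutator ip V2 V1 x)
      = cross_commutator ip V2 V1 (cross_commutator ip V1 V2 x).
    by case: nK => _; rewrite (adjoint_eq ipP (cross_adjoint ipP adj1 adj2)).
  have [x [beta [b x1 dec V2E [onb total]]]] :=
    pair_shift_model ipP adj1 adj2 AV1 AV2 V12 irr rank2 Knormal.
  have bb : beta^* * beta = 1 by rewrite mulrC -normCK b expr1n.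
  rewrite {}V2E in irr *; split.
  - by move=> l; apply: (shift_defect_eigenvalue ipP adj1 AV1 x1 dec b).
  - exact: (shift_cross_rank ipP adj1 AV1 x1 dec b).
  exists beta; split=> //.
    exact: (shift_cross_spectrum ipP adj1 AV1 x1 dec b).
  (* The intertwining unitary is the coefficient map of the orthonormal basis [V1^n x], on which
     [V1] acts as an index shift. *)
  pose E n := iter n V1 x.
  have UV y : onb_coef ip E (V1 y) = Mz (onb_coef ip E y).
    apply: h2_ext => n; rewrite MzE (onb_coefE ipP onb).
    case: n => [|n] /=; first exact: (shift_ip_cokernel ipP AV1 x1 dec).
    by rewrite adj1 AV1 (onb_coefE ipP onb).
  exists (onb_coef ip E); split=> [a y z|f|y z|y].
  - exact: onb_coef_linear.
  - exact: onb_coef_surj.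
  - exact: onb_coef_isometry.
  - split=> //; apply: h2_ext => n.
    by rewrite h2Z -UV !(onb_coefE ipP onb) (ipZl ipP).
(* For the converse, the shift model is applied to [Mz] and [back_shift], with [h2_one] as [e]. *)
have ipP := @h2inner_product R.
have one1 : h2inner (@h2_one R) h2_one = 1 by rewrite h2inner_one h2_oneE.
split.
- exact: (shift_irreducible ipP (@Mz_adjoint R) (@back_shiftK R)
    (@Mz_decomposition R) (@back_shift_pure R)).
- exact: (shift_two_finite ipP (@Mz_adjoint R) (@back_shiftK R) one1
    (@Mz_decomposition R) a1 (@back_shift_pure R)).
- exact: (shift_defect_eigenvalue ipP (@Mz_adjoint R) (@back_shiftK R) one1
    (@Mz_decomposition R) a1).
Qed.
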